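(* Let $A$ and $B$ be distributive groups of finite orders $v$ and $\mu$, with compositions $a.a'$ and $b\odot b'$ respectively. Then the set of all pairs $(a,b)$ with $a\in A$, $b\in B$, equipped with the composition $(a,b)\times(a',b')=(a.a',\,b\odot b')$, is a distributive group of order $v\mu$.
   Context: A distributive group is a nonempty set $G$ with a binary operation $(a,b)\mapsto a.b$ on $G$ such that for all $a,b\in G$ each of the equations $a.x=b$ and $y.a=b$ has exactly one solution in $G$, and for all $a,b,c\in G$, $(a.b).c=(a.c).(b.c)$ and $c.(a.b)=(c.a).(c.b)$. Its order is its number of elements. *)

(* Defs.v *)
From mathcomp Require Import all_boot.

Set Implicit Arguments.
Unset Strict Implicit.
Unset Printing Implicit Defensive.

(* [left_distributive op op] is (a.b).c = (a.c).(b.c) and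
   [right_distributive op op] is c.(a.b) = (c.a).(c.b). *)
Record distributive_group (G : Type) (op : G -> G -> G) : Prop :=
  DistributiveGroup {
    dg_nonempty : inhabited G;
    dg_solve_right : forall a b : G, exists! x : G, op a x = b;
    dg_solve_left : forall a b : G, exists! y : G, op y a = b;
    dg_left_distr : left_distributive op op;
    dg_right_distr : right_distributive op op
  }.

Definition prod_op (A B : Type) (opA : A -> A -> A) (opB : B -> B -> B)
    (p q : A * B) : A * B :=
  (opA p.1 q.1, opB p.2 q.2).

(* Main.v *)
Require Import Defs.
From mathcomp Require Import all_boot.

(** An equation in the product composition is a pair of independent equations,
    one in each factor. The unique solvability of the product equations is
    therefore the coordinatewise combination of those of the factors
    ([exists_unique_pair]), and the distributive laws, being identities, hold
    because they hold in each coordinate. *)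

Lemma exists_unique_pair (A B : Type) (P : A -> Prop) (Q : B -> Prop)
    (R : A * B -> Prop) :
  (forall p, R p <-> P p.1 /\ Q p.2) ->
  (exists! x, P x) -> (exists! y, Q y) -> exists! p, R p.
Proof.
move=> RE [x [Px x_uniq]] [y [Qy y_uniq]]; exists (x, y); split; first exact/RE.
by move=> [x' y'] /RE [/= /x_uniq <- /y_uniq <-].
Qed.

Lemma prod_distributive_group (A B : Type)
    (opA : A -> A -> A) (opB : B -> B -> B) :
  distributive_group opA -> distributive_group opB ->
  distributive_group (prod_op opA opB).
Proof.
move=> [[a0] solrA sollA ldA rdA] [[b0] solrB sollB ldB rdB]; split.
- exact: (inhabits (a0, b0)).
- move=> [a b] [a' b'].
  apply: exists_unique_pair (solrA a a') (solrB b b') => p.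
  by split=> [[-> ->] | [/= eqA eqB]] //; rewrite /prod_op /= eqA eqB.
- move=> [a b] [a' b'].
  apply: exists_unique_pair (sollA a a') (sollB b b') => p.
  by split=> [[-> ->] | [/= eqA eqB]] //; rewrite /prod_op /= eqA eqB.
- by move=> p q r; rewrite /prod_op /= ldA ldB.
- by move=> p q r; rewrite /prod_op /= rdA rdB.
Qed.

Theorem mainTheorem3 (A B : finType) (opA : A -> A -> A) (opB : B -> B -> B)
    (v mu : nat)
    (hA : distributive_group opA) (hvA : #|A| = v)
    (hB : distributive_group opB) (hmuB : #|B| = mu) :
  distributive_group (prod_op opA opB) /\ #|{: A * B}| = v * mu.
Proof.
split; first exact: prod_distributive_group.
by rewrite card_prod hvA hmuB.
Qed.
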